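(* For every unit interval graph $G$, $\mathrm{fun}(G)\le 2$.
   Context: All graphs are finite, simple (undirected, no loops, no multiple edges), with nonempty vertex set. For a graph $G=(V,E)$ let $A(x,y)=1$ if $x,y\in V$ are adjacent and $A(x,y)=0$ otherwise. Functionality: a vertex $y\in V$ is a function of vertices $x_1,\dots,x_k\in V\setminus\{y\}$ if there exists a Boolean function $f:\{0,1\}^k\to\{0,1\}$ such that for every $z\in V\setminus\{y,x_1,\dots,x_k\}$, $A(y,z)=f(A(x_1,z),\dots,A(x_k,z))$. The functionality $\mathrm{fun}(y)$ of $y$ (in $G$) is the minimum $k\ge 0$ such that $y$ is a function of some $k$ vertices. The functionality of the graph is $\mathrm{fun}(G)=\max_H\min_{y\in V(H)}\mathrm{fun}(y)$, where the maximum is over all (nonempty) induced subgraphs $H$ of $G$ and $\mathrm{fun}(y)$ is computed in $H$. A unit interval graph is the intersection graph of a finite family of intervals of the same length on the real line: vertices correspond to the intervals, and two distinct vertices are adjacent if and only if the corresponding intervals intersect. *)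

(* Defs.v *)
From mathcomp Require Import classical_sets set_interval reals.
From mathcomp Require Import all_boot all_order all_algebra.

Set Implicit Arguments.
Unset Strict Implicit.
Unset Printing Implicit Defensive.

Record sgraph := SGraph {
  vertex :> finType;
  adj : rel vertex;
  adj_sym : symmetric adj;
  adj_irr : irreflexive adj;
  vertex_gt0 : 0 < #|vertex| }.

Section Induced.
Variables (G : sgraph) (S : {set G}) (S0 : S != set0).

Definition induced_adj : rel {x : G | x \in S} :=
  fun u v => adj (val u) (val v).

Lemma induced_adj_sym : symmetric induced_adj.
Proof. by move=> u v; apply: adj_sym. Qed.

Lemma induced_adj_irr : irreflexive induced_adj.
Proof. by move=> u; apply: adj_irr. Qed.

Lemma induced_vertex_gt0 : 0 < #|{: {x : G | x \in S}}|.
Proof. by rewrite card_sig card_gt0. Qed.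

Definition induced : sgraph :=
  SGraph induced_adj_sym induced_adj_irr induced_vertex_gt0.
End Induced.

Section Functionality.
Variable G : sgraph.

(* The x_i need not be distinct; repetitions do not affect the minimal k. *)
Definition function_of (y : G) (k : nat) (x : k.-tuple G) : bool :=
  (y \notin x) &&
  [exists f : {ffun k.-tuple bool -> bool},
     [forall z : G, (z != y) && (z \notin x) ==>
        (adj y z == f [tuple adj (tnth x i) z | i < k])]].

Definition function_of_some (y : G) (k : nat) : bool :=
  [exists x : k.-tuple G, function_of y x].

Lemma ex_function_of_some (y : G) : exists k, function_of_some y k.
Proof.
exists (size (enum (predC1 y))); apply/existsP; exists (in_tuple (enum (predC1 y))).
apply/andP; split; first by rewrite mem_enum !inE eqxx.
apply/existsP; exists [ffun=> false]; apply/forallP => z.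
by rewrite mem_enum !inE andbN.
Qed.

Definition vertex_functionality (y : G) : nat :=
  ex_minn (ex_function_of_some y).

Lemma ex_vertex_functionality :
  exists k, [exists y : G, vertex_functionality y == k].
Proof.
have /card_gt0P[y _] := vertex_gt0 G.
by exists (vertex_functionality y); apply/existsP; exists y.
Qed.

Definition min_functionality : nat := ex_minn ex_vertex_functionality.
End Functionality.

Definition functionality (G : sgraph) : nat :=
  \max_(S : {S : {set G} | S != set0}) min_functionality (induced (valP S)).

(* Intervals are closed: mixing open and closed intervals of one length would
   give a larger class, containing the claw. Distinct vertices may carry the
   same interval; the vertex x carries [a x, a x + l]. *)
Definition unit_interval_graph (R : realType) (G : sgraph) : Prop :=
  exists (l : R) (a : G -> R), (0 < l)%R /\
    forall x y : G, x != y ->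
      (adj x y <->
       (`[a x, a x + l] `&` `[a y, a y + l] !=set0)%R%classic).

(* Main.v *)
Require Import Defs.
From mathcomp Require Import classical_sets set_interval reals.
From mathcomp Require Import all_boot all_order all_algebra.

Set Implicit Arguments.
Unset Strict Implicit.
Unset Printing Implicit Defensive.

Import Order.TTheory GRing.Theory Num.Theory.

(** Order the vertices by their intervals, so that every closed neighbourhood
is an order interval. If the last vertex is isolated, its functionality is 0.
Otherwise some adjacent pair [u < v] has the same neighbours to the right of
[v]; take such a pair with [v] minimal. Then [u] and [v] are consecutive, so
they are distinguished only by vertices [z < u] adjacent to [u] but not to [v].
Two such vertices would both have [u] as their last neighbour, and would thus
form a pair as above to the left of [v]. So at most one vertex [q]
distinguishes [u] from [v], and [v] is a function of [u] and [q]. *)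

(** This is the umbrella-free form of the condition on closed neighbourhoods. Ranks need only be
    injective, not consecutive, so [r] restricts to induced subgraphs without renumbering. *)
Definition indifference_order (G : sgraph) (r : G -> nat) : Prop :=
  injective r /\
  forall x y z : G, r x < r y -> r y < r z -> adj x z -> adj x y && adj y z.

Lemma unit_interval_indifference_order (R : realType) (G : sgraph) :
  unit_interval_graph R G -> exists r : G -> nat, indifference_order r.
Proof.
case=> l [a [l_gt0 adjP]].
(* The rank is the position in a list sorted by left endpoint, which breaks ties between equal
   intervals. *)
pose s := sort (fun x y => (a x <= a y)%R) (enum G).
have s_mem x : x \in s by rewrite mem_sort mem_enum.
have r_inj : injective (index^~ s).
  by move=> x y /(congr1 (nth x s)); rewrite !nth_index.
have a_mono x y : index x s < index y s -> (a x <= a y)%R.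
  apply: (@sorted_ltn_index _ (fun x y => (a x <= a y)%R)) => //.
    by move=> ? ? ?; apply: le_trans.
  by apply: sort_sorted => ? ?; apply: le_total.
exists (index^~ s); split=> // x y z xy yz.
have neq u v : index u s < index v s -> u != v.
  by apply: contraTneq => ->; rewrite ltnn.
have [axy ayz] := (a_mono _ _ xy, a_mono _ _ yz).
case/(adjP _ _ (neq _ _ (ltn_trans xy yz))) => t /= [].
rewrite !in_itv /= => /andP[_ tx] /andP[zt _].
have azx : (a z <= a x + l)%R by apply: le_trans tx.
apply/andP; split.
  (* The chain [a x <= a y <= a z <= a x + l <= a y + l] puts [a y] in the interval of [x] and [a z]
     in that of [y]. *)
  apply/(adjP _ _ (neq _ _ xy)); exists (a y).
  by rewrite /= !in_itv /= axy lexx (le_trans ayz) //= lerDl ltW.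
apply/(adjP _ _ (neq _ _ yz)); exists (a z).
by rewrite /= !in_itv /= ayz lexx (le_trans azx) ?lerD2r //= lerDl ltW.
Qed.

Lemma induced_indifference_order (G : sgraph) (r : G -> nat)
    (S : {set G}) (S0 : S != set0) :
  indifference_order r ->
  indifference_order (fun x : induced S0 => r (val x)).
Proof.
case=> r_inj r_conv; split=> [x y /r_inj/val_inj // | x y z].
exact: r_conv.
Qed.

Definition right_twins (G : sgraph) (r : G -> nat) (u v : G) : bool :=
  [&& r u < r v, adj u v & [forall z, (r v < r z) ==> (adj u z == adj v z)]].

(** Up to [v], convexity of the edge [u v] makes [u] and [w] adjacent to everything after [w].
    Beyond [v], the right neighbours of [w] include those of [u] and are included in those of [v],
    and these two sets agree. *)
Lemma right_twins_consecutive (G : sgraph) (r : G -> nat) (u v w : G) :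
  indifference_order r -> right_twins r u v -> r u < r w -> r w < r v ->
  right_twins r u w.
Proof.
case=> r_inj r_conv /and3P[uv auv /forallP tw] uw wv.
have /andP[auw awv] := r_conv _ _ _ uw wv auv.
apply/and3P; split=> //; apply/forallP=> z; apply/implyP=> wz; apply/eqP.
case: (ltngtP (r z) (r v)) => [zv | vz | /r_inj->]; last by rewrite auv awv.
  have /andP[-> _] := r_conv _ _ _ (ltn_trans uw wz) zv auv.
  by have /andP[-> _] := r_conv _ _ _ wz zv awv.
have /eqP auz := implyP (tw z) vz.
apply/idP/idP=> [| awz]; first by case/(r_conv _ _ _ uw wz)/andP.
by rewrite auz; case/andP: (r_conv _ _ _ wv vz awz).
Qed.

(** Both [p] and [q] are adjacent to everything after [q] up to [u]. Any later vertex is [v] or lies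
    beyond it, and an edge from [p] or [q] to it would force an edge to [v]. *)
Lemma right_twins_of_distinguishers (G : sgraph) (r : G -> nat) (u v p q : G) :
  indifference_order r -> r u < r v ->
  (forall w, ~~ ((r u < r w) && (r w < r v))) ->
  r p < r q -> r q < r u -> adj p u -> ~~ adj p v -> adj q u -> ~~ adj q v ->
  right_twins r p q.
Proof.
case=> r_inj r_conv uv gap pq qu apu npv aqu nqv.
have [pu qv] := (ltn_trans pq qu, ltn_trans qu uv).
have /andP[apq _] := r_conv _ _ _ pq qu apu.
apply/and3P; split=> //; apply/forallP=> w; apply/implyP=> qw; apply/eqP.
case: (ltngtP (r w) (r u)) => [wu | uw | /r_inj->]; last by rewrite apu aqu.
  have /andP[-> _] := r_conv _ _ _ (ltn_trans pq qw) wu apu.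
  by have /andP[-> _] := r_conv _ _ _ qw wu aqu.
have vw : r v <= r w by have := gap w; rewrite uw -leqNgt.
have right_nonadj x : r x < r v -> ~~ adj x v -> adj x w = false.
  move=> xv nxv; apply/negbTE/negP => axw; case/negP: nxv.
  move: vw; rewrite leq_eqVlt => /orP[/eqP/r_inj-> // | vw].
  by case/andP: (r_conv _ _ _ xv vw axw).
by rewrite !right_nonadj // (ltn_trans pq).
Qed.

Lemma isolated_or_almost_twins (G : sgraph) (r : G -> nat) :
  indifference_order r ->
  (exists v : G, forall z, adj v z = false) \/
  (exists v u q : G, [/\ v != u, v != q &
    forall z, z != v -> z != u -> z != q -> adj v z = adj u z]).
Proof.
move=> r_ord; have [r_inj r_conv] := r_ord.
have /card_gt0P[x0 _] := vertex_gt0 G.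
have [top _ r_top] := @arg_maxnP G x0 xpredT r isT.
have topP z : r z <= r top by exact: r_top.
case: (pickP (adj top)) => [x atx | ?]; last by left; exists top.
(* Nothing lies to the right of [top], so any neighbour of it forms such a pair with it. *)
right; have x_top : [exists u, right_twins r u top].
  apply/existsP; exists x; apply/and3P; split.
  - rewrite ltn_neqAle topP // andbT; apply: contraTneq atx => /r_inj->.
    by rewrite adj_irr.
  - by rewrite adj_sym.
  - by apply/forallP=> z; rewrite ltnNge topP.
have [v /existsP[u uv_tw] v_min] :=
  @arg_minnP G top (fun v => [exists u, right_twins r u v]) r x_top.
have no_twins p q : r q < r v -> ~~ right_twins r p q.
  rewrite ltnNge; apply: contraNN => pq_tw.
  by apply: v_min; apply/existsP; exists p.
have /and3P[uv auv /forallP tw] := uv_tw.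
have gap w : ~~ ((r u < r w) && (r w < r v)).
  apply/negP=> /andP[uw wv].
  by have /negP[] := no_twins u w wv; apply: right_twins_consecutive uv_tw uw wv.
have neq_vu : v != u by apply: contraTneq uv => ->; rewrite ltnn.
(* To the left of [u], convexity makes every neighbour of [v] a neighbour of [u], so a difference
   can only go this way. *)
pose D z := [&& r z < r u, adj z u & ~~ adj z v].
have D_uniq p q : D p -> D q -> p = q.
  have no_lt p' q' : r p' < r q' -> D p' -> D q' -> False.
    move=> pq /and3P[_ apu npv] /and3P[qu aqu nqv].
    have /negP[] := no_twins p' q' (ltn_trans qu uv).
    exact: (right_twins_of_distinguishers r_ord uv gap).
  move=> Dp Dq; case: (ltngtP (r p) (r q)) => [pq | qp | /r_inj //].
    by case: (no_lt p q).
  by case: (no_lt q p).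
have D_neq z : D z -> z != v.
  by case/and3P=> zu _ _; apply: contraTneq (ltn_trans zu uv) => ->; rewrite ltnn.
have almost z : z != v -> z != u -> ~~ D z -> adj v z = adj u z.
  move=> zv zu nDz; case: (ltngtP (r z) (r u)) => [lt_zu | uz | /r_inj ezu].
  - move: nDz; rewrite /D lt_zu /= negb_and negbK [in RHS]adj_sym [in LHS]adj_sym.
    case azv: (adj z v) => /=; last by rewrite orbF => /negbTE->.
    by case/andP: (r_conv _ _ _ lt_zu uv azv) => ->.
  - case: (ltngtP (r z) (r v)) => [lt_zv | vz | /r_inj ezv].
    + by have := gap z; rewrite uz lt_zv.
    + by apply/esym/eqP; exact: implyP (tw z) vz.
    + by rewrite ezv eqxx in zv.
  - by rewrite ezu eqxx in zu.
case: (pickP D) => [q Dq | D0].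
  exists v, u, q; split=> // [|z zv zu zq]; first by rewrite eq_sym D_neq.
  by apply: almost => //; apply: contra_neqN zq => Dz; apply: D_uniq.
(* Without a distinguisher, [u] is repeated in place of [q]. *)
by exists v, u, u; split=> // z zv zu _; apply: almost; rewrite ?D0.
Qed.

Lemma function_of_nil (G : sgraph) (v : G) :
  (forall z, adj v z = false) -> function_of v [tuple].
Proof.
move=> v0; apply/andP; split=> //.
apply/existsP; exists [ffun=> false]; apply/forallP=> z.
by rewrite ffunE v0 eqxx implybT.
Qed.

Lemma function_of_almost_twin (G : sgraph) (v u q : G) :
  v != u -> v != q ->
  (forall z, z != v -> z != u -> z != q -> adj v z = adj u z) ->
  function_of v [tuple u; q].
Proof.
move=> vu vq tw; apply/andP; split; first by rewrite !inE negb_or vu.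
(* The function is the projection to the value at [u]; listing [q] exempts it from the condition. *)
apply/existsP; exists [ffun t => tnth t ord0]; apply/forallP=> z.
apply/implyP; rewrite !inE negb_or => /and3P[zv zu zq].
by rewrite ffunE tnth_mktuple (tw z).
Qed.

Lemma min_functionality_le (G : sgraph) (v : G) (k : nat) (x : k.-tuple G) :
  function_of v x -> min_functionality G <= k.
Proof.
move=> vx; apply: (@leq_trans (vertex_functionality v)).
  rewrite /min_functionality; case: ex_minnP => m _; apply.
  by apply/existsP; exists v.
rewrite /vertex_functionality; case: ex_minnP => m _; apply.
by apply/existsP; exists x.
Qed.

Lemma min_functionality_indifference_order (G : sgraph) (r : G -> nat) :
  indifference_order r -> min_functionality G <= 2.
Proof.
case/isolated_or_almost_twins=> [[v v0] | [v [u [q [vu vq tw]]]]].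
  exact: leq_trans (min_functionality_le (function_of_nil v0)) _.
exact: min_functionality_le (function_of_almost_twin vu vq tw).
Qed.

Theorem theorem3 (R : realType) (G : sgraph) (hG : unit_interval_graph R G) :
  functionality G <= 2.
Proof.
have [r r_ord] := unit_interval_indifference_order hG.
apply/bigmax_leqP=> S _.
exact: min_functionality_indifference_order (induced_indifference_order (valP S) r_ord).
Qed.
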